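(* Let $\mathcal{O}$ be a finite set of total-function-preserving $\mathrm{GSO}$-definable operations on binary relations. Then there is a total-function-preserving operation $O$ that is term definable in $\mathbb{TRA}$ but not term definable in $\mathbb{BRA}(\mathcal{O})$, even over finite structures in which every relation is a total function.
   Context: Structures have signatures consisting of binary relation symbols only. An $n$-ary operation on binary relations is an isomorphism-invariant map $O$ sending each structure $A=(\mathrm{dom}(A),R_1^A,\dots,R_n^A)$ to a binary relation $O(A)\subseteq \mathrm{dom}(A)^2$. For a set $\mathcal{O}$ of operations, $\mathbb{BRA}(\mathcal{O})$ has as $n$-ary terms the expressions built from relation symbols $R_1,\dots,R_n$ using operations in $\mathcal{O}$; an operation is term definable in $\mathbb{BRA}(\mathcal{O})$ (over a class of structures) if some term defines the same relation as it on every structure (of the class). $\mathbb{TRA}=\mathbb{BRA}(\mathrm{id},\emptyset,-,\cap,\circ,{}^\smile)$ (identity relation, empty relation, complement, intersection, composition, inverse). An operation $O$ is total-function preserving if whenever every $R_i^A$ is a total function on $\mathrm{dom}(A)$, then $O(A)$ is a total function on $\mathrm{dom}(A)$. Guarded second-order logic $\mathrm{GSO}$ extends first-order logic with quantification over sets of elements and quantification over subsets of the interpretations of relation symbols of the signature. An operation $O$ is $\mathrm{GSO}$-definable if there is a $\mathrm{GSO}$-formula $\phi(x,y)$ with $O(A)=\{(a,b)\mid A\models\phi(a,b)\}$ for all $A$. *)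

(* Defs.v *)
From mathcomp Require Import all_boot.
From mathcomp Require Import boolp classical_sets functions cardinality.

Set Implicit Arguments.
Unset Strict Implicit.
Unset Printing Implicit Defensive.

Local Open Scope classical_set_scope.
Local Open Scope relation_scope.

(* The relation symbols of an n-ary signature are the elements of 'I_n. *)
Record structure (n : nat) := Structure {
  dom :> Type;
  interp : 'I_n -> set (dom * dom) }.

Arguments interp {n} A i _ : rename.

Definition isomorphism n (A B : structure n) (f : A -> B) :=
  bijective f /\
  forall (i : 'I_n) (x y : A), interp B i (f x, f y) <-> interp A i (x, y).

Record operation := Operation {
  arity : nat;
  apply :> forall A : structure arity, set (A * A);
  apply_iso : forall (A B : structure arity) (f : A -> B),
    isomorphism f -> forall x y : A, @apply B (f x, f y) <-> @apply A (x, y) }.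

Arguments apply O A _ : rename.

Definition total_function (D : Type) (R : set (D * D)) :=
  forall x : D, exists! y : D, R (x, y).

Definition total_functional n (A : structure n) :=
  forall i : 'I_n, total_function (interp A i).

Definition total_function_preserving (O : operation) :=
  forall A : structure (arity O), total_functional A -> total_function (O A).

(* Terms of BRA(Ops) over the relation symbols 'I_n. *)
Inductive bra_term (Ops : set operation) (n : nat) : Type :=
| BVar of 'I_n
| BApp (o : operation) of Ops o & ('I_(arity o) -> bra_term Ops n).

Fixpoint bra_eval (Ops : set operation) (n : nat) (A : structure n)
    (t : bra_term Ops n) : set (A * A) :=
  match t with
  | BVar i => interp A i
  | BApp o _ ts => o (@Structure (arity o) A (fun i => @bra_eval Ops n A (ts i)))
  end.

Arguments bra_eval {Ops n} A t _ : rename.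

Definition term_definable (Ops : set operation) (O : operation)
    (C : set (structure (arity O))) :=
  exists t : bra_term Ops (arity O),
    forall A : structure (arity O), C A -> bra_eval A t = O A.

Arguments term_definable Ops O C : clear implicits.

Definition bra_id_map (A : structure 0) : set (A * A) := diagonal.

Definition bra_empty_map (A : structure 0) : set (A * A) := set0.

Definition bra_compl_map (A : structure 1) : set (A * A) := ~` interp A ord0.

Definition bra_cap_map (A : structure 2) : set (A * A) :=
  interp A ord0 `&` interp A ord_max.

(* In the library's B \; A the relation A is applied first. *)
Definition bra_comp_map (A : structure 2) : set (A * A) :=
  interp A ord_max \; interp A ord0.

Definition bra_conv_map (A : structure 1) : set (A * A) := (interp A ord0)^-1.

Fact bra_id_iso (A B : structure 0) (f : A -> B) : isomorphism f ->
  forall x y : A, bra_id_map (f x, f y) <-> bra_id_map (x, y).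
Proof.
by move=> [/bij_inj fI _] x y; rewrite /bra_id_map !diagonalP; split=> [/fI|->].
Qed.

Fact bra_empty_iso (A B : structure 0) (f : A -> B) : isomorphism f ->
  forall x y : A, @bra_empty_map B (f x, f y) <-> @bra_empty_map A (x, y).
Proof. by []. Qed.

Fact bra_compl_iso (A B : structure 1) (f : A -> B) : isomorphism f ->
  forall x y : A, bra_compl_map (f x, f y) <-> bra_compl_map (x, y).
Proof. by move=> [_ fR] x y; split=> + /fR. Qed.

Fact bra_cap_iso (A B : structure 2) (f : A -> B) : isomorphism f ->
  forall x y : A, bra_cap_map (f x, f y) <-> bra_cap_map (x, y).
Proof. by move=> [_ fR] x y; split=> -[/fR ? /fR ?]. Qed.

Fact bra_comp_iso (A B : structure 2) (f : A -> B) : isomorphism f ->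
  forall x y : A, bra_comp_map (f x, f y) <-> bra_comp_map (x, y).
Proof.
move=> [[g fK gK] fR] x y; split=> -[z /= Rxz Rzy].
  by exists (g z) => /=; apply/fR; rewrite gK.
by exists (f z); apply/fR.
Qed.

Fact bra_conv_iso (A B : structure 1) (f : A -> B) : isomorphism f ->
  forall x y : A, bra_conv_map (f x, f y) <-> bra_conv_map (x, y).
Proof. by move=> [_ fR] x y; exact: fR. Qed.

Definition bra_id := Operation bra_id_iso.
Definition bra_empty := Operation bra_empty_iso.
Definition bra_compl := Operation bra_compl_iso.
Definition bra_cap := Operation bra_cap_iso.
Definition bra_comp := Operation bra_comp_iso.
Definition bra_conv := Operation bra_conv_iso.

Definition TRA : set operation :=
  [set bra_id; bra_empty; bra_compl; bra_cap; bra_comp; bra_conv].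

(* Well-scoped de Bruijn syntax: [gso n k s r] is the type of GSO formulas over
   n binary relation symbols whose free variables are among k element
   variables, s set variables and r guarded binary relation variables.  The
   remaining connectives and the universal quantifiers are expressible. *)
Inductive gso (n : nat) : nat -> nat -> nat -> Type :=
| GEq k s r (x y : 'I_k) : gso n k s r
| GRel k s r (i : 'I_n) (x y : 'I_k) : gso n k s r
| GSetVar k s r (X : 'I_s) (x : 'I_k) : gso n k s r
| GRelVar k s r (Y : 'I_r) (x y : 'I_k) : gso n k s r
| GNot k s r : gso n k s r -> gso n k s r
| GAnd k s r : gso n k s r -> gso n k s r -> gso n k s r
| GEx k s r : gso n k.+1 s r -> gso n k s r
| GExSet k s r : gso n k s.+1 r -> gso n k s r
| GExSub k s r (i : 'I_n) : gso n k s r.+1 -> gso n k s r.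

Fixpoint gso_sat n (A : structure n) k s r (phi : gso n k s r) :
    k.-tuple A -> s.-tuple (set A) -> r.-tuple (set (A * A)) -> Prop :=
  match phi with
  | GEq _ _ _ x y => fun v _ _ => tnth v x = tnth v y
  | GRel _ _ _ i x y => fun v _ _ => interp A i (tnth v x, tnth v y)
  | GSetVar _ _ _ X x => fun v V _ => tnth V X (tnth v x)
  | GRelVar _ _ _ Y x y => fun v _ W => tnth W Y (tnth v x, tnth v y)
  | GNot _ _ _ p => fun v V W => ~ gso_sat p v V W
  | GAnd _ _ _ p q => fun v V W => gso_sat p v V W /\ gso_sat q v V W
  | GEx _ _ _ p => fun v V W =>
      exists a : A, gso_sat p [tuple of a :: v] V W
  | GExSet _ _ _ p => fun v V W =>
      exists S : set A, gso_sat p v [tuple of S :: V] W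
  | GExSub _ _ _ i p => fun v V W =>
      exists2 S : set (A * A), S `<=` interp A i &
        gso_sat p v V [tuple of S :: W]
  end.

Definition gso_definable (O : operation) :=
  exists phi : gso (arity O) 2 0 0, forall A : structure (arity O),
    O A = [set p | gso_sat phi [tuple p.1; p.2] [tuple] [tuple]].

(* Main.v *)
(** Blow up the directed cycle of length n + 3 by replacing every vertex by three
    twins, and take as elements the vertices and the edges, with the two
    functions that send an edge to its source and to its target.  By symmetry,
    the only invariant total functions on this structure are the identity,
    source and target, so each operation restricts to a finite table on it.  By
    pigeonhole, two cycles of different lengths have the same tables for all
    operations in [Ops], hence every term denotes the same one of the three
    functions on both.  But TRA can test whether there is a closed walk of a
    given length, and return source or the identity accordingly. *)
Require Import Defs.
From mathcomp Require Import all_boot.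
From mathcomp Require Import boolp classical_sets functions cardinality.
From mathcomp Require Import ssralg zmodp.

Set Implicit Arguments.
Unset Strict Implicit.
Unset Printing Implicit Defensive.

Import GRing.Theory.

Local Open Scope classical_set_scope.

(** * Terms as invariant operations, and derived terms of Tarski's algebra *)

Lemma bra_eval_iso (Ops : set operation) n (t : bra_term Ops n)
    (A B : structure n) (f : A -> B) :
  isomorphism f ->
  forall x y : A, bra_eval B t (f x, f y) <-> bra_eval A t (x, y).
Proof.
move=> [fbij fR]; elim: t => [i|o Oo ts IH] x y /=; first exact: fR.
exact: (@apply_iso o (Structure (fun i => bra_eval A (ts i)))
  (Structure (fun i => bra_eval B (ts i))) f).
Qed.

Definition term_operation (Ops : set operation) n (t : bra_term Ops n) :=
  @Operation n (fun A => bra_eval A t) (bra_eval_iso t).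

Section TarskiTerms.
Variable n : nat.
Implicit Types (A : structure n) (s t c : bra_term TRA n).

Fact TRA_id : TRA bra_id. Proof. by rewrite /TRA; do 5 left. Qed.
Fact TRA_compl : TRA bra_compl. Proof. by rewrite /TRA; do 3 left; right. Qed.
Fact TRA_cap : TRA bra_cap. Proof. by rewrite /TRA; do 2 left; right. Qed.
Fact TRA_comp : TRA bra_comp. Proof. by rewrite /TRA; left; right. Qed.
Fact TRA_conv : TRA bra_conv. Proof. by rewrite /TRA; right. Qed.

Definition pair_args s t (i : 'I_2) := if i == ord0 then s else t.

Definition tid :=
  BApp TRA_id (fun i : 'I_0 => BVar TRA (widen_ord (leq0n n) i)).
Definition tcompl t := BApp TRA_compl (fun=> t).
Definition tcap s t := BApp TRA_cap (pair_args s t).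
Definition tcomp s t := BApp TRA_comp (pair_args s t).
Definition tconv t := BApp TRA_conv (fun=> t).
Definition ttop := tcompl (tcap tid (tcompl tid)).
Definition tpow t k := iter k (tcomp t) tid.
(** [c1] is the full relation if [c] is nonempty and empty otherwise, so a global test becomes a
    union of two intersections, written by De Morgan. *)
Definition tif c s t :=
  let c1 := tcomp (tcomp ttop c) ttop in
  tcompl (tcap (tcompl (tcap s c1)) (tcompl (tcap t (tcompl c1)))).

Lemma bra_eval_tid A x y : bra_eval A tid (x, y) <-> x = y.
Proof. by []. Qed.

Lemma bra_eval_tcompl A t x y :
  bra_eval A (tcompl t) (x, y) <-> ~ bra_eval A t (x, y).
Proof. by []. Qed.

Lemma bra_eval_tcap A s t x y :
  bra_eval A (tcap s t) (x, y) <-> bra_eval A s (x, y) /\ bra_eval A t (x, y).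
Proof. by []. Qed.

Lemma bra_eval_tcomp A s t x y : bra_eval A (tcomp s t) (x, y) <->
  exists2 z, bra_eval A s (x, z) & bra_eval A t (z, y).
Proof. by []. Qed.

Lemma bra_eval_tconv A t x y :
  bra_eval A (tconv t) (x, y) <-> bra_eval A t (y, x).
Proof. by []. Qed.

Lemma bra_eval_ttop A x y : bra_eval A ttop (x, y).
Proof. by apply/bra_eval_tcompl => /bra_eval_tcap[? /bra_eval_tcompl]. Qed.

Lemma bra_eval_tif A c s t x y : bra_eval A (tif c s t) (x, y) <->
  bra_eval A (if `[< bra_eval A c !=set0 >] then s else t) (x, y).
Proof.
rewrite /tif; set c1 := tcomp _ _.
have c1P : bra_eval A c1 (x, y) <-> bra_eval A c !=set0.
  split=> [/bra_eval_tcomp[z /bra_eval_tcomp[w _ cwz] _]|[[w z] cwz]].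
    by exists (w, z).
  apply/bra_eval_tcomp; exists z; last exact: bra_eval_ttop.
  by apply/bra_eval_tcomp; exists w => //; exact: bra_eval_ttop.
rewrite bra_eval_tcompl bra_eval_tcap !bra_eval_tcompl !bra_eval_tcap.
rewrite bra_eval_tcompl c1P.
case: asboolP => cA; have [|] := pselect (bra_eval A s (x, y));
  have [|] := pselect (bra_eval A t (x, y)); tauto.
Qed.

End TarskiTerms.

(** * The blown-up cycle, its automorphisms and its invariant functions *)

Section Blowup.
Variable n : nat.
Local Open Scope ring_scope.

(* [(i, a, None)] is the a-th twin of the i-th cycle vertex, and
   [(i, a, Some b)] is the edge from [(i, a, None)] to [(i + 1, b, None)]. *)
Definition incidence := ('I_n.+3 * 'I_3 * option 'I_3)%type.

Implicit Types x y : incidence.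

Definition source x : incidence := (x.1, None).
Definition target x : incidence :=
  if x.2 is Some b then (x.1.1 + 1, b, None) else x.

Definition endpoint (c : option bool) : incidence -> incidence :=
  match c with None => id | Some false => source | Some true => target end.

Definition graph_endpoint c : set (incidence * incidence) :=
  [set p | p.2 = endpoint c p.1].

Lemma endpoint_vertex c v : endpoint c (v, None) = (v, None).
Proof. by case: c => [[]|]. Qed.

Lemma graph_endpoint_inj : injective graph_endpoint.
Proof.
(* The three maps agree on vertices; an edge tells them apart. *)
pose e : incidence := (0, 0, Some 0).
move=> c d cd; have : graph_endpoint d (e, endpoint c e) by rewrite -cd.
by case: c {cd} => [[]|]; case: d => [[]|].
Qed.

(** Rotation by [s] after permuting the twins of each layer [i] by [sigma i]. The head of an edge
    lies one layer further on, hence the index [x.1.1 + 1]. *)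
Definition cycle_aut (s : 'I_n.+3) (sigma : 'I_n.+3 -> 'I_3 -> 'I_3) x :
    incidence :=
  (x.1.1 + s, sigma x.1.1 x.1.2, omap (sigma (x.1.1 + 1)) x.2).

Lemma cycle_aut_bij s sigma :
  (forall i, injective (sigma i)) -> bijective (cycle_aut s sigma).
Proof.
move=> sI; apply: injF_bij => -[[i a] o] [[j b] p] /= E.
have /= /addIr ij := congr1 (fun z => z.1.1) E.
have /= := congr1 (fun z => z.1.2) E.
have /= := congr1 snd E.
rewrite -{}ij => op /sI <-; congr (_, _).
by case: o p op {E} => [c|] [d|] //= [/sI ->].
Qed.

Lemma cycle_aut_endpoint s sigma c x :
  cycle_aut s sigma (endpoint c x) = endpoint c (cycle_aut s sigma x).
Proof.
by case: x => [[i a] [b|]]; case: c => [[]|] //=; rewrite /cycle_aut/= addrAC.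
Qed.

(** The transposition of the three twins that fixes [c] alone. Two twins would not do: no
    permutation of two points has exactly one fixed point. *)
Definition reflect3 (c a : 'I_3) : 'I_3 := c + c - a.

Lemma reflect3_inj c : injective (reflect3 c).
Proof. by move=> a b /addrI/oppr_inj. Qed.

Lemma reflect3_fix c a : reflect3 c a = a <-> a = c.
Proof.
split=> [|->]; last by rewrite /reflect3 addrK.
by case: c a => [[|[|[|]]]] // ? [[|[|[|]]]] // ? /(congr1 val) // _;
  apply: val_inj.
Qed.

Lemma cycle_aut_reflect3_fix (p : 'I_n.+3 -> 'I_3) i a o :
  cycle_aut 0 (fun j => reflect3 (p j)) (i, a, o) = (i, a, o) <->
  a = p i /\ forall b, o = Some b -> b = p (i + 1).
Proof.
rewrite /cycle_aut/= addr0; split=> [E|[-> op]].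
  have /= /reflect3_fix -> := congr1 (fun z => z.1.2) E.
  have /= oE := congr1 snd E; split=> // b ob.
  by move: oE; rewrite ob => /(@Some_inj _ _ _)/reflect3_fix.
have /reflect3_fix -> : p i = p i by [].
by case: o op => //= b /(_ b erefl)/reflect3_fix ->.
Qed.

Lemma two_neq0_cycle : 1 + 1 != 0 :> 'I_n.+3.
Proof.
rewrite -(mulr2n 1) Zp_nat; apply/eqP => /(congr1 val).
by rewrite /= modn_small.
Qed.

(* A point fixed by all automorphisms fixing x involves only vertices incident
   to x: t is an arbitrary choice of fixed twin on the other layers. *)
Lemma cycle_aut_stable x y :
  (forall p : 'I_n.+3 -> 'I_3,
     let r := cycle_aut 0 (fun j => reflect3 (p j)) in r x = x -> r y = y) ->
  exists c, y = endpoint c x.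
Proof.
have i1 (i : 'I_n.+3) : (i + 1 == i) = false.
  by rewrite -[X in _ == X]addr0 (inj_eq (addrI i)) oner_eq0.
have i2 (i : 'I_n.+3) : (i + 1 + 1 == i) = false.
  rewrite -[X in _ == X]addr0 -addrA (inj_eq (addrI i)).
  exact: negbTE two_neq0_cycle.
case: x y => [[i a] [b|]] [[j c] o] /= H.
  pose p t k := if k == i then a else if k == i + 1 then b else t.
  have {}H t : c = p t j /\ forall d, o = Some d -> d = p t (j + 1).
    apply/cycle_aut_reflect3_fix/H/cycle_aut_reflect3_fix.
    by rewrite /p eqxx i1; split=> // d []; rewrite eqxx.
  (* Two values of [t] exclude every layer whose twin is left arbitrary. *)
  have {H} := (H 0, H 1); rewrite /p.
  have [->|ji] := eqVneq j i.
    case: o => [d|] [[-> +] _]; last by exists (Some false).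
    by move=> /(_ d erefl); rewrite i1 eqxx => ->; exists None.
  have [->|ji1] := eqVneq j (i + 1).
    (* An edge leaving layer [i + 1] would have its head in layer [i + 1 + 1], where the twin is
       arbitrary. *)
    case: o => [d|] [[-> +] [_ +]]; last by exists (Some true).
    by move=> /(_ d erefl) + /(_ d erefl); rewrite i1 i2 => ->.
  by case=> -[-> _] [].
pose p t k := if k == i then a else t.
have {}H t : c = p t j /\ forall d, o = Some d -> d = p t (j + 1).
  by apply/cycle_aut_reflect3_fix/H/cycle_aut_reflect3_fix; rewrite /p eqxx.
have {H} := (H 0, H 1); rewrite /p.
have [->|ji] := eqVneq j i; last by case=> -[-> _] [].
case: o => [d|] [[-> +] [_ +]]; last by exists None.
by move=> /(_ d erefl) + /(_ d erefl); rewrite i1 => ->.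
Qed.

(** The value at [x] is fixed by the stabiliser of [x], hence an endpoint of [x]. Automorphisms are
    transitive on edges, so the choice made at one edge holds at all, and at vertices the choices
    coincide. *)
Lemma invariant_total_function (R : set (incidence * incidence)) :
  total_function R ->
  (forall s sigma, (forall i, injective (sigma i)) -> forall x y,
    R (cycle_aut s sigma x, cycle_aut s sigma y) <-> R (x, y)) ->
  exists c, R = graph_endpoint c.
Proof.
move=> /choice[h Rh] Raut.
have RE x y : R (x, y) <-> y = h x.
  by have [Rx hu] := Rh x; split=> [/hu|->].
have haut s sigma x : (forall i, injective (sigma i)) ->
    h (cycle_aut s sigma x) = cycle_aut s sigma (h x).
  by move=> sI; apply/esym/RE/Raut => //; apply/RE.
have hE x : exists c, h x = endpoint c x.
  apply: cycle_aut_stable => p /= px.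
  by rewrite -haut ?px // => i; exact: reflect3_inj.
have [c hc] := hE (0, 0, Some 0); exists c.
suff hcE x : h x = endpoint c x.
  by apply/seteqP; split=> -[x y]; rewrite /graph_endpoint /= RE hcE.
case: x => [[i a] [b|]]; last first.
  by have [d ->] := hE (i, a, None); rewrite !endpoint_vertex.
(* Together with rotation by [i], this carries the base edge to the given one. *)
pose sigma (j : 'I_n.+3) (k : 'I_3) := k + (if j == 0 then a else b).
have -> : (i, a, Some b) = cycle_aut i sigma (0, 0, Some 0).
  by rewrite /cycle_aut /sigma /= !add0r.
by rewrite -cycle_aut_endpoint -hc haut // => j; exact: addIr.
Qed.

(* The universe of [dom] lies strictly below that of ['I_n], so the domain has
   to be a copy of [incidence] in [Set]. *)
Definition code := {k : nat | (k < #|{: incidence}|)%N}.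

Definition encode x : code := exist _ (enum_rank x : nat) (ltn_ord _).
Definition decode (d : code) : incidence := enum_val (Ordinal (svalP d)).

Lemma encodeK : cancel encode decode.
Proof.
move=> x; rewrite /decode -[RHS]enum_rankK; congr enum_val.
exact: val_inj.
Qed.

Lemma decodeK : cancel decode encode.
Proof.
case=> k klt; apply: eq_exist; rewrite /decode enum_valK.
by [].
Qed.

(** * The blow-up as a structure, and operations restricted to it *)

Definition endpoint_rel c : set (code * code) :=
  [set p | graph_endpoint c (decode p.1, decode p.2)].

Lemma endpoint_rel_inj : injective endpoint_rel.
Proof.
move=> c d cd; apply: graph_endpoint_inj; apply/seteqP.
have E x y : graph_endpoint c (x, y) = graph_endpoint d (x, y).
  have := congr1 (@^~ (encode x, encode y)) cd.
  by rewrite /endpoint_rel/= !encodeK.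
by split=> -[x y]; rewrite E.
Qed.

Lemma endpoint_rel_total c : total_function (endpoint_rel c).
Proof.
move=> d; exists (encode (endpoint c (decode d))); split.
  by rewrite /endpoint_rel/= encodeK.
by move=> e; rewrite /endpoint_rel /graph_endpoint /= => <-; rewrite decodeK.
Qed.

Definition blowup : structure 2 :=
  Structure (fun i => endpoint_rel (Some (i == ord_max))).

Lemma blowup_finite : finite_set [set: dom blowup].
Proof.
suff -> : [set: dom blowup] = encode @` setT.
  exact/finite_image/finite_finset.
by apply/seteqP; split=> // d _; exists (decode d) => //; rewrite decodeK.
Qed.

(** Automorphisms of the blow-up commute with the endpoint maps, so they preserve the output of [o],
    and the classification of invariant total functions applies. *)
Lemma operation_on_endpoints (o : operation)
    (tau : 'I_(arity o) -> option bool) :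
  total_function_preserving o ->
  exists c, o (Structure (endpoint_rel \o tau)) = endpoint_rel c.
Proof.
move=> otf; set A := Structure _.
have oA : total_function (o A) by apply: otf => i; exact: endpoint_rel_total.
have [x|s sigma sI x y|c RE] := @invariant_total_function
  [set p | o A (encode p.1, encode p.2)].
- have [d [xd du]] := oA (encode x); exists (decode d); split.
    by rewrite /= decodeK.
  by move=> y /= /du ->; rewrite encodeK.
- pose f : A -> A := encode \o cycle_aut s sigma \o decode.
  have fE z : encode (cycle_aut s sigma z) = f (encode z).
    by rewrite /f /= encodeK.
  rewrite /= !fE; apply: apply_iso; split.
    apply: bij_comp; last by exists encode; [exact: decodeK|exact: encodeK].
    apply: bij_comp; last exact: cycle_aut_bij.
    by exists decode; [exact: encodeK|exact: decodeK].
  move=> i {}x {}y; rewrite /A /f /= /endpoint_rel /graph_endpoint /= !encodeK.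
  rewrite -cycle_aut_endpoint.
  by split=> [/(bij_inj (cycle_aut_bij s sI))|->].
exists c; apply/seteqP; split=> -[d e];
  by rewrite /endpoint_rel /= -RE /= !decodeK.
Qed.

End Blowup.

(** * The closed-walk operation and its values on blow-ups *)

Definition src_term : bra_term TRA 2 := BVar TRA ord0.
Definition tgt_term : bra_term TRA 2 := BVar TRA ord_max.

(** Vertices are their own source and target; removing the identity leaves only the pairs given by
    edges. *)
Definition step_term :=
  tcap (tcomp (tconv src_term) tgt_term) (tcompl (tid 2)).

Definition closed_walk_term k := tcap (tpow step_term k) (tid 2).

Definition closed_walk_op k :=
  term_operation (tif (closed_walk_term k) src_term (tid 2)).

Lemma closed_walk_op_total k : total_function_preserving (closed_walk_op k).
Proof.
move=> A Atf x /=.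
case: (asboolP (bra_eval A (closed_walk_term k) !=set0)) => w.
  have [y [xy yu]] := Atf ord0 x; exists y; split.
    by apply/bra_eval_tif; rewrite asboolT.
  by move=> z /bra_eval_tif; rewrite asboolT // => /yu.
exists x; split.
  by apply/bra_eval_tif; rewrite asboolF //; exact/bra_eval_tid.
by move=> z /bra_eval_tif; rewrite asboolF.
Qed.

Section ClosedWalks.
Variable n : nat.
Local Open Scope ring_scope.
Implicit Types x y : blowup n.

Lemma src_blowup x y :
  bra_eval (blowup n) src_term (x, y) <-> decode y = source (decode x).
Proof. by []. Qed.

Lemma tgt_blowup x y :
  bra_eval (blowup n) tgt_term (x, y) <-> decode y = target (decode x).
Proof. by []. Qed.

Lemma step_blowup x y : bra_eval (blowup n) step_term (x, y) <->
  exists i a b, decode x = (i, a, None) /\ decode y = (i + 1, b, None).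
Proof.
rewrite bra_eval_tcap bra_eval_tcomp bra_eval_tcompl bra_eval_tid; split.
  case=> -[e /bra_eval_tconv/src_blowup + /tgt_blowup].
  case: (decode e) => -[i a] [b|] xE yE; first by exists i, a, b.
  by case; rewrite -[x]decodeK -[y]decodeK xE yE.
case=> i [a [b [xE yE]]]; split.
  exists (encode (i, a, Some b)).
    by apply/bra_eval_tconv/src_blowup; rewrite encodeK.
  by apply/tgt_blowup; rewrite encodeK.
move=> xy; have /= /eqP := congr1 (fun z => z.1.1) yE.
by rewrite -xy xE /= -[X in X == _]addr0 (inj_eq (addrI i)) eq_sym oner_eq0.
Qed.

Lemma walk_blowup k x y : bra_eval (blowup n) (tpow step_term k) (x, y) ->
  (decode y).1.1 = (decode x).1.1 + k%:R.
Proof.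
elim: k x => [|k IH] x; first by move=> /bra_eval_tid ->; rewrite addr0.
case/bra_eval_tcomp=> z /step_blowup[i [a [b [xE zE]]]] /IH ->.
by rewrite xE zE /= -addrA -mulrS.
Qed.

Lemma walk_blowup_exists k i a : bra_eval (blowup n) (tpow step_term k)
  (encode (i, a, None), encode (i + k%:R, a, None)).
Proof.
elim: k i => [|k IH] i; first by apply/bra_eval_tid; rewrite addr0.
apply/bra_eval_tcomp; exists (encode (i + 1, a, None)).
  by apply/step_blowup; exists i, a, a; rewrite !encodeK.
by rewrite mulrS addrA; exact: IH.
Qed.

(** Each step advances the layer by one, so a walk can close only if [k] is zero modulo the cycle
    length; staying on one twin index then closes it. *)
Lemma closed_walk_blowup k :
  bra_eval (blowup n) (closed_walk_term k) !=set0 <-> (n.+3 %| k)%N.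
Proof.
have -> : (n.+3 %| k)%N = (k%:R == 0 :> 'I_n.+3) by rewrite Zp_nat.
split=> [[[x y] /bra_eval_tcap[/walk_blowup + /bra_eval_tid xy]]|/eqP k0].
  by rewrite -xy -[X in X = _]addr0 => /addrI <-.
exists (encode (0, 0, None), encode (0 + k%:R, 0, None)).
apply/bra_eval_tcap; split; first exact: walk_blowup_exists.
by rewrite k0 addr0.
Qed.

Lemma closed_walk_op_blowup k : closed_walk_op k (blowup n) =
  endpoint_rel (if (n.+3 %| k)%N then Some false else None).
Proof.
have -> : (n.+3 %| k)%N =
    `[< bra_eval (blowup n) (closed_walk_term k) !=set0 >].
  by apply/idP/asboolP => /closed_walk_blowup.
set w := `[< _ >]; have wP x y : closed_walk_op k (blowup n) (x, y) <->
    endpoint_rel (if w then Some false else None) (x, y).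
  apply: (iff_trans (@bra_eval_tif _ _ _ _ _ x y)); rewrite -/w.
  case: w => /=; first exact: src_blowup.
  by split=> [/bra_eval_tid ->|/(can_inj (@decodeK n))/esym ?];
    [|exact/bra_eval_tid].
by apply/seteqP; split=> -[x y] /wP.
Qed.

End ClosedWalks.

(** * Pigeonhole on operation tables, and the separation *)

Lemma finite_colouring_collision (T : finType) (f : nat -> T) :
  exists n m, (n < m)%N /\ f n = f m.
Proof.
have /injectivePn[i [j ij fij]] : ~~ injectiveb (fun i : 'I_#|T|.+1 => f i).
  by apply/injectiveP => /leq_card; rewrite card_ord ltnn.
case: (ltngtP i j) => ltij; [by exists i, j|by exists j, i|].
by case/eqP: ij; apply: val_inj.
Qed.

(** One implication suffices: for total-function-preserving [o], [operation_on_endpoints] supplies a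
    [c] on the first blow-up. *)
Definition same_table n m (o : operation) :=
  forall (tau : 'I_(arity o) -> option bool) c,
    o (Structure (@endpoint_rel n \o tau)) = endpoint_rel c ->
    o (Structure (@endpoint_rel m \o tau)) = endpoint_rel c.

Lemma same_table_exists (Ops : set operation) : finite_set Ops ->
  exists n m, (n < m)%N /\ forall o, Ops o -> same_table n m o.
Proof.
move=> [N /card_set_bijP[r [rN rI _]]].
(* [e] inverts the numbering [r] of [Ops], with [bra_id] as default value. *)
have /choice[e eP] (j : 'I_N) :
    exists o, forall o', Ops o' -> r o' = j -> o = o'.
  have [[o Oo ro]|noo] := pselect (exists2 o, Ops o & r o = j).
    by exists o => o' Oo' ro'; apply: rI; rewrite ?inE // ro ro'.
  by exists bra_id => o Oo ro; case: noo; exists o.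
(* All tables together form one colour in a finite type that does not depend on [k]; the dependent
   pair accommodates the different arities. *)
pose table k := [ffun p : {j : 'I_N & {ffun 'I_(arity (e j)) -> option bool}} *
    option bool =>
  `[< e (tag p.1) (Structure (@endpoint_rel k \o tagged p.1)) =
      endpoint_rel p.2 >]].
have [n [m [nm tnm]]] := finite_colouring_collision table.
exists n, m; split=> // o Oo.
have ltrN : (r o < N)%N by exact: rN.
rewrite -(eP (Ordinal ltrN) o Oo erefl) => tau c nE.
have := congr1 (fun t : {ffun _} => t (Tagged _ (finfun tau), c)) tnm.
have tauE k : @endpoint_rel k \o finfun tau = @endpoint_rel k \o tau.
  by apply/funext => i; rewrite /= ffunE.
by rewrite !ffunE /= !tauE (asboolT nE) => /esym/asboolW.
Qed.

(** By induction the arguments of an operation carry the same labels [tau] on both blow-ups, and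
    equal tables give equal output labels. *)
Lemma bra_eval_blowup (Ops : set operation) n m (t : bra_term Ops 2) :
  (forall o, Ops o -> total_function_preserving o) ->
  (forall o, Ops o -> same_table n m o) ->
  exists c, bra_eval (blowup n) t = endpoint_rel c /\
            bra_eval (blowup m) t = endpoint_rel c.
Proof.
move=> Otf Otab; elim: t => [i|o Oo ts /choice[tau tauE]] /=.
  by exists (Some (i == ord_max)).
have tsE k : (forall i, bra_eval (blowup k) (ts i) = endpoint_rel (tau i)) ->
    (fun i => bra_eval (blowup k) (ts i)) = @endpoint_rel k \o tau.
  by move=> tauk; apply/funext => i; rewrite tauk.
have [c oc] := @operation_on_endpoints n o tau (Otf o Oo).
exists c; rewrite !tsE => [|i|i]; try by have [] := tauE i.
by split; last exact: (Otab o Oo).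
Qed.

Theorem theorem8 (Ops : set operation)
  (finOps : finite_set Ops)
  (tfpOps : forall o : operation, Ops o -> total_function_preserving o)
  (gsoOps : forall o : operation, Ops o -> gso_definable o) :
  exists O : operation,
    [/\ total_function_preserving O,
        term_definable TRA O [set: structure (arity O)]
      & ~ term_definable Ops O
            [set A | finite_set [set: dom A] /\ total_functional A]].
Proof.
have [n [m [nm tab]]] := same_table_exists finOps.
(* The walk length is that of the shorter cycle, which the longer length cannot divide: the
   operation is source on one blow-up and the identity on the other. *)
exists (closed_walk_op n.+3); split; first exact: closed_walk_op_total.
  by exists (tif (closed_walk_term n.+3) src_term (tid 2)).
case=> t tE; have [c []] := bra_eval_blowup t tfpOps tab.
have blowupC k :
    finite_set [set: dom (blowup k)] /\ total_functional (blowup k).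
  by split=> [|i]; [exact: blowup_finite|exact: endpoint_rel_total].
rewrite (tE _ (blowupC n)) (tE _ (blowupC m)) !closed_walk_op_blowup dvdnn.
move=> /endpoint_rel_inj <-.
by rewrite gtnNdvd // => /endpoint_rel_inj.
Qed.
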